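(* For every integer $n>1$, \[ a(n)=\frac{n}{n-\varphi(n)}+\sum_{\substack{d\mid n\\ d\neq 1}}\frac{\varphi\left(\frac{n}{d}\right)a\left(\frac{n}{d}\right)}{n-\varphi(n)} =\frac{1}{n-\varphi(n)}\left(n+\sum_{\substack{d\mid n\\ d\neq n}}\varphi(d)\,a(d)\right), \] where $\varphi$ is Euler's totient function.
   Context: For a positive integer $n$, consider the random walk on $\mathbb{Z}/n\mathbb{Z}$ that starts at the residue $1 \pmod n$ and at each step multiplies the current state by a residue chosen uniformly at random from $\mathbb{Z}/n\mathbb{Z}$, independently of previous choices. The state $0\pmod n$ is absorbing. $a(n)$ denotes the expected number of steps until the walk first reaches $0 \pmod n$ (so $a(1)=0$). *)

(* Defs.v *)
From HB Require Import structures.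
From mathcomp Require Import all_boot all_order all_algebra.
From mathcomp Require Import all_classical all_reals all_analysis.

Set Implicit Arguments.
Unset Strict Implicit.
Unset Printing Implicit Defensive.

Import Order.TTheory GRing.Theory Num.Theory.

Local Open Scope classical_set_scope.
Local Open Scope ring_scope.
Local Open Scope ereal_scope.

(* Z/nZ for n > 0, with the operations Zp0, Zp1 and Zp_mul of zmodp. The ring
   'Z_n is not used because it is Z/2Z for n = 1; here n = 1 gives the
   one-element type, in which Zp1 = Zp0. *)
Notation residue n := ('I_(n.-1.+1)).

(* V carries the discrete sigma-algebra, hence the arbitrary sets A k. *)
Definition mutually_independent (R : realType) (d : measure_display)
    (Omega : measurableType d) (P : probability Omega R) (V : Type)
    (X : nat -> Omega -> V) : Prop :=
  forall (s : seq nat) (A : nat -> set V), uniq s ->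
    P (\bigcap_(k in [set` s]) (X k @^-1` A k)) =
    \prod_(k <- s) P (X k @^-1` A k).

Record iid_uniform_steps (R : realType) (n : nat) (d : measure_display)
    (Omega : measurableType d) (P : probability Omega R)
    (X : nat -> Omega -> residue n) : Prop := IidUniformSteps {
  steps_measurable : forall k (A : set (residue n)), measurable (X k @^-1` A);
  steps_uniform : forall k (r : residue n),
    P (X k @^-1` [set r]) = ((n%:R : R)^-1)%:E;
  steps_independent : mutually_independent P X
}.

Fixpoint walk (n : nat) (Omega : Type) (X : nat -> Omega -> residue n)
    (k : nat) (w : Omega) : residue n :=
  if k is k'.+1 then Zp_mul (walk X k' w) (X k' w) else Zp1.

(* The infimum of the empty set is +oo: the value on trajectories that never
   reach 0. *)
Definition absorption_time (R : realType) (n : nat) (Omega : Type)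
    (X : nat -> Omega -> residue n) (w : Omega) : \bar R :=
  ereal_inf [set (k%:R : R)%:E | k in [set k : nat | walk X k w = Zp0]].

(* The expectation depends only on the law of the steps, so it does not matter
   which probability space carries them. *)
Definition is_expected_absorption_time (R : realType) (n : nat) (e : \bar R) :
    Prop :=
  exists (d : measure_display) (Omega : measurableType d)
    (P : probability Omega R) (X : nat -> Omega -> residue n),
    iid_uniform_steps P X /\ e = \int[P]_w absorption_time R X w.

(* Main.v *)
Require Import Defs.
From HB Require Import structures.
From mathcomp Require Import all_boot all_order all_algebra.
From mathcomp Require Import all_classical all_reals all_analysis.
From mathcomp Require Import ring lra.

(** Multiplying by r in Z/nZ turns the walk on Z/nZ into the walk on Z/mZ with
    m = n / gcd(r, n), and exactly phi(d) residues r give m = d for each d | n.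
    Conditioning on one step, the probability q_k(n) that the walk is not yet
    absorbed after k steps satisfies n q_{k+1}(n) = sum_{d | n} phi(d) q_k(d).
    The absorption time is the number of k at which the walk is not at 0, so
    a(n) = sum_k q_k(n), whence n a(n) = n + sum_{d | n} phi(d) a(d) for n > 1.
    The same recursion bounds the partial sums of a(n) by induction on n, so a(n)
    is finite and the term phi(n) a(n) can be moved to the left-hand side. *)

Import Order.TTheory GRing.Theory Num.Theory.

Local Open Scope classical_set_scope.
Local Open Scope ring_scope.

(** * Gcd and totient identities for residues *)

Lemma sum_modn (V : nmodType) (F : nat -> V) (m q : nat) :
  \sum_(x < q * m) F (x %% m)%N = (\sum_(x < m) F x) *+ q.
Proof.
rewrite -(big_mkord xpredT (fun x => F (x %% m)%N)) mulnC.
elim: q => [|q IH]; first by rewrite muln0 big_geq // mulr0n.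
rewrite mulnS addnC (@big_cat_nat _ _ _ (m * q)) ?leq_addr //= IH mulrSr; congr (_ + _).
rewrite -{1}[(m * q)%N]add0n big_addn addKn big_mkord.
by apply: eq_bigr => i _; rewrite addnC mulnC modnMDl modn_small.
Qed.

(** Write g = gcd(r, n), n = g m and r = g r'. Then gcd(r x, n) = g gcd(r' x, m), where r' is
    coprime to m and drops out. So the quotient n / gcd of the next state depends only on the
    current quotient m and on x modulo m. *)
Lemma divn_gcdM (n r x : nat) : (0 < n)%N ->
  let m := (n %/ gcdn r n)%N in
  (n %/ gcdn (r * x) n = m %/ gcdn (x %% m) m)%N.
Proof.
move=> n0; set g := gcdn r n; set m := (n %/ g)%N => /=.
have g0 : (0 < g)%N by rewrite gcdn_gt0 n0 orbT.
have en : n = (g * m)%N by rewrite mulnC divnK ?dvdn_gcdr.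
have er : r = (g * (r %/ g))%N by rewrite mulnC divnK ?dvdn_gcdl.
have co : coprime m (r %/ g).
  by rewrite coprime_sym /coprime -(eqn_pmul2l g0) muln_gcdr -er -en muln1.
rewrite gcdn_modl er en -mulnA -muln_gcdr [gcdn (_ * x) m]gcdnC Gauss_gcdr //.
by rewrite divnMl // gcdnC.
Qed.

(** Cut the range into d blocks of length e. Only the first element j e of a block is divisible by
    e, and gcd(j e, d e) = e exactly when j is coprime to d. *)
Lemma sum_gcdn_eq (d e : nat) : (0 < e)%N ->
  (\sum_(x < d * e) (gcdn x (d * e) == e) = totient d)%N.
Proof.
move=> e0; rewrite totient_count_coprime.
rewrite -(big_mkord xpredT (fun x => (gcdn x (d * e) == e) : nat)) big_nat_mul.
apply: eq_big_nat => j _.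
have je : (j * e < j.+1 * e)%N by rewrite ltn_pmul2r.
rewrite big_ltn // -muln_gcdl.
have -> : (gcdn j d * e == e)%N = coprime d j by rewrite /coprime gcdnC -{2}[e]mul1n eqn_pmul2r.
rewrite big1_seq => [|i]; first exact: addn0.
rewrite mem_index_iota => /andP[_ /andP[lo hi]].
apply/eqP; rewrite eqb0; apply/negP => /eqP eg.
have : (e %| i)%N by rewrite -eg dvdn_gcdl.
move=> /dvdnP[c ec]; move: lo hi; rewrite ec.
by rewrite !ltn_pmul2r // ltnS => jc /(leq_trans jc); rewrite ltnn.
Qed.

(** Group the x by d = m / gcd(x, m), that is, by gcd(x, m) = m / d; [sum_gcdn_eq] counts each
    class. *)
Lemma sum_divn_gcd (V : nmodType) (F : nat -> V) (m : nat) : (0 < m)%N ->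
  \sum_(x < m) F (m %/ gcdn x m)%N = \sum_(d <- divisors m) F d *+ totient d.
Proof.
move=> m0.
transitivity (\sum_(x < m) \sum_(d <- divisors m) F d *+ (gcdn x m == m %/ d)%N).
  apply: eq_bigr => x _.
  have gm := dvdn_gcdr x m.
  rewrite (bigD1_seq (m %/ gcdn x m)%N) ?divisors_uniq //=; last first.
    by rewrite -dvdn_divisors // dvdn_div.
  rewrite divnA // mulKn // eqxx mulr1n big1_seq ?addr0 // => d /andP[dN dm].
  rewrite -dvdn_divisors // in dm.
  case: eqP => // eg; case/eqP: dN; rewrite eg divnA // mulKn //.
rewrite exchange_big /=; apply: eq_big_seq => d; rewrite -dvdn_divisors // => dm.
rewrite sumrMnr; congr (_ *+ _).
have e0 : (0 < m %/ d)%N by rewrite divn_gt0 ?(dvdn_gt0 m0 dm) // dvdn_leq.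
rewrite -(sum_gcdn_eq d (m %/ d) e0).
by rewrite [(d * _)%N]mulnC divnK.
Qed.

(** The residue 0 is not coprime to n. This makes the denominator n - phi(n) positive. *)
Lemma ltn_totient (n : nat) : (1 < n)%N -> (totient n < n)%N.
Proof.
move=> n1; rewrite totient_count_coprime big_ltn ?(ltnW n1) //.
rewrite {1}/coprime gcdn0 gtn_eqF // add0n.
apply: (@leq_ltn_trans (\sum_(1 <= i < n) 1)%N); first by apply: leq_sum => i _; case: coprime.
by rewrite sum_nat_const_nat muln1 ltn_subrL (ltnW n1).
Qed.

(* [survival k m] is the probability that the walk on Z/mZ has not reached 0
   after k steps.  Started at r in Z/nZ instead of 1, the walk behaves like the
   one on Z/mZ with m = n / gcd(r, n), whence the recursion on the first step. *)
Fixpoint survival (R : realType) (k m : nat) : R :=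
  if k is k'.+1 then m%:R^-1 * \sum_(x < m) survival R k' (m %/ gcdn x m)%N
  else (m != 1%N)%:R.

(** * Survival probabilities: recursion and bounded partial sums *)

Section Survival.
Variable R : realType.
Local Notation survival := (survival R).

Lemma survival_ge0 (k m : nat) : 0 <= survival k m.
Proof.
by elim: k m => [|k IH] m //=; rewrite mulr_ge0 ?invr_ge0 ?ler0n // sumr_ge0.
Qed.

Lemma survival_modulus1 (k : nat) : survival k 1 = 0.
Proof. by elim: k => [|k IH] //=; rewrite big_ord1 /= gcdn1 divn1 IH mulr0. Qed.

Lemma survivalS (k m : nat) : (0 < m)%N ->
  m%:R * survival k.+1 m = \sum_(d <- divisors m) (totient d)%:R * survival k d.
Proof.
move=> m0; rewrite /= mulVKf ?pnatr_eq0 -?lt0n // sum_divn_gcd //.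
by apply: eq_bigr => d _; rewrite mulr_natl.
Qed.

Lemma survival_step (k n r : nat) : (0 < n)%N ->
  n%:R^-1 * \sum_(x < n) survival k (n %/ gcdn (r * x) n)%N
    = survival k.+1 (n %/ gcdn r n)%N.
Proof.
move=> n0; have g0 : (0 < gcdn r n)%N by rewrite gcdn_gt0 n0 orbT.
set m := (n %/ gcdn r n)%N.
have en : n = (gcdn r n * m)%N by rewrite mulnC divnK ?dvdn_gcdr.
have m0 : (0 < m)%N by rewrite divn_gt0 // dvdn_leq // dvdn_gcdr.
under eq_bigr do rewrite (divn_gcdM _ _ _ n0) -/m.
have nE : n%:R = (gcdn r n)%:R * m%:R :> R by rewrite -natrM -en.
(* For x below n = g m, with g = gcd(r, n), each residue modulo m occurs g times; this g cancels
   against the one in n. *)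
have -> : \sum_(x < n) survival k (m %/ gcdn (x %% m) m)%N
    = (\sum_(x < m) survival k (m %/ gcdn x m)%N) *+ gcdn r n.
  by rewrite -(sum_modn _ (fun y => survival k (m %/ gcdn y m)%N)) -en.
rewrite /= nE -mulr_natr; field.
by rewrite !pnatr_eq0 -!lt0n g0 m0.
Qed.

(** The term k = 0 equals 1 and contributes m; the others are [survivalS] summed over k. *)
Lemma survival_sum_recr (K m : nat) : (1 < m)%N ->
  m%:R * \sum_(k < K.+1) survival k m =
    m%:R + \sum_(d <- divisors m) (totient d)%:R * \sum_(k < K) survival k d.
Proof.
move=> m1; rewrite big_ord_recl /= gtn_eqF // mulrDr mulr1 mulr_sumr; congr (_ + _).
rewrite (eq_bigr (fun i : 'I_K => \sum_(d <- divisors m) (totient d)%:R * survival i d)).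
  by rewrite exchange_big /=; apply: eq_bigr => d _; rewrite mulr_sumr.
by move=> i _; apply: survivalS (ltnW m1).
Qed.

Lemma survival_sum_le (K L m : nat) : (K <= L)%N ->
  \sum_(k < K) survival k m <= \sum_(k < L) survival k m.
Proof.
move=> KL; rewrite -!(big_mkord xpredT (fun k => survival k m)).
by rewrite (@big_cat_nat _ _ _ K 0 L) //= lerDl sumr_ge0 // => i _; apply: survival_ge0.
Qed.

(** Strong induction on m. In the recursion for partial sums, proper divisors are bounded by
    induction, and the term d = m is at most phi(m) times the left-hand sum, so it can be absorbed
    because phi(m) < m. *)
Lemma survival_sum_bounded (m : nat) : (0 < m)%N ->
  exists C : R, forall K, \sum_(k < K) survival k m <= C.
Proof.
elim/ltn_ind: m => m IH m0.
have [m1|m1] := leqP m 1.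
  have -> : m = 1%N by apply/eqP; rewrite eqn_leq m1 m0.
  by exists 0 => K; rewrite big1 // => k _; rewrite survival_modulus1.
(* One bound per d is chosen as a function, so that the bounds can be summed over divisors. *)
have /choice[C CP] : forall d, exists c : R, (0 < d < m)%N ->
    forall K, \sum_(k < K) survival k d <= c.
  move=> d; have [/andP[d0 dm]|_] := boolP (0 < d < m)%N; last by exists 0.
  by have [c cP] := IH d dm d0; exists c.
set B := \sum_(d <- divisors m | d != m) (totient d)%:R * C d.
have mt : 0 < m%:R - (totient m)%:R :> R by rewrite subr_gt0 ltr_nat ltn_totient.
(* The constant solves m S <= m + phi(m) S + B for S. *)
exists ((m%:R + B) / (m%:R - (totient m)%:R)) => K.
apply: le_trans (survival_sum_le _ _ _ (leqnSn K)) _.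
set S := \sum_(k < K.+1) survival k m.
have SK : \sum_(k < K) survival k m <= S by apply: survival_sum_le.
rewrite ler_pdivlMr // mulrBr [S * m%:R]mulrC survival_sum_recr // lerBlDr -addrA lerD2l.
rewrite (bigD1_seq m) ?divisors_uniq -?dvdn_divisors //= addrC.
apply: lerD; last by rewrite [leRHS]mulrC; apply: ler_wpM2l.
rewrite /B [leLHS]big_seq_cond [leRHS]big_seq_cond; apply: ler_sum => d.
rewrite -dvdn_divisors // => /andP[dm dN].
apply: ler_wpM2l; [exact: ler0n | apply: CP].
by rewrite (dvdn_gt0 m0 dm) ltn_neqAle dN dvdn_leq.
Qed.

End Survival.

(** * The law of the walk on a probability space *)

Section Walk.
Variables (R : realType) (n : nat) (d : measure_display) (Omega : measurableType d).
Variables (P : probability Omega R) (X : nat -> Omega -> residue n).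
Hypotheses (n0 : (0 < n)%N) (HX : iid_uniform_steps P X).

Lemma bigcup_fiber (V : finType) (f : Omega -> V) (E : set Omega) :
  E = \bigcup_(x : V) (f @^-1` [set x] `&` E).
Proof.
by apply/seteqP; split=> [w Ew | w [x _ []]//]; exists (f w).
Qed.

(** Induction on k: on each of the finitely many fibers of [X k], the event is a preimage under the
    walk at time k. *)
Lemma measurable_walk (k : nat) (B : set (residue n)) : measurable (walk X k @^-1` B).
Proof.
elim: k B => [|k IH] B.
  rewrite [S in measurable S](_ : _ = [set w | B Zp1]) //.
  have [BT|BF] := pselect (B Zp1).
    by rewrite (_ : [set _ | _] = setT) //; apply/seteqP; split.
  by rewrite (_ : [set _ | _] = set0) //; apply/seteqP; split.
rewrite [S in measurable S](bigcup_fiber _ (X k)); apply: fin_bigcup_measurable => // x _.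
rewrite (_ : _ `&` _ = X k @^-1` [set x] `&` walk X k @^-1` [set y | B (Zp_mul y x)]).
  by apply: measurableI; [exact: (steps_measurable HX) | exact: IH].
by apply/seteqP; split=> w /= [<-].
Qed.

Lemma measurable_cylinder (s : seq nat) (A : nat -> set (residue n)) :
  measurable (\bigcap_(i in [set` s]) (X i @^-1` A i)).
Proof.
rewrite bigcap_seq; apply: bigsetI_measurable => i _; exact: (steps_measurable HX).
Qed.

(** Total probability, used to condition on the value of one step. *)
Lemma measure_fibers (V : finType) (f : Omega -> V) (E : set Omega) :
  (forall x, measurable (f @^-1` [set x])) -> measurable E ->
  P E = (\sum_(x : V) P (f @^-1` [set x] `&` E))%E.
Proof.
move=> mf mE; rewrite {1}(bigcup_fiber _ f E) measure_fin_bigcup //.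
- rewrite [RHS]bigfs ?index_enum_uniq // => [|x _]; last by rewrite mem_index_enum.
  by apply: eq_fsbigl; apply/seteqP; split.
- exact: finite_finset.
- by move=> x y _ _ [w [[/= <- _] [/= <- _]]].
- by move=> x _; apply: measurableI.
Qed.

(* The conditioning that drives the induction is on the steps of index >= k,
   on which [walk X k] does not depend. *)
Lemma prob_cylinder_survive (k : nat) (s : seq nat) (A : nat -> set (residue n))
    (r : residue n) :
  uniq s -> (forall i, i \in s -> (k <= i)%N) ->
  (P (\bigcap_(i in [set` s]) (X i @^-1` A i)
      `&` [set w | Zp_mul r (walk X k w) <> Zp0])
   = \prod_(i <- s) P (X i @^-1` A i)
     * (survival R k (n %/ gcdn r n))%:E)%E.
Proof.
elim: k s A r => [|k IH] s A r us sk.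
  rewrite -(steps_independent HX) //= Zp_mulz1.
  have rn : (r < n)%N by rewrite -[ltnRHS](prednK n0).
  have [r0|r0] := eqVneq r Zp0.
    rewrite r0 gcd0n divnn n0 /= mule0.
    have -> : [set w : Omega | @Zp0 n.-1 <> Zp0] = set0.
      by apply/seteqP; split=> w //= /(_ erefl).
    by rewrite setI0 measure0.
  have r0' : (0 < r)%N by rewrite lt0n; apply: contra_neq r0 => r0; apply: val_inj.
  have -> : [set w : Omega | r <> Zp0] = setT.
    by apply/seteqP; split=> w //= _; apply/eqP.
  rewrite setIT.
  (* Since 0 < r < n, gcd(r, n) <= r < n and the quotient exceeds 1. *)
  have -> : (n %/ gcdn r n != 1)%N.
    rewrite neq_ltn ltn_divRL ?dvdn_gcdr // mul1n (leq_ltn_trans _ rn) ?orbT //.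
    by rewrite dvdn_leq // dvdn_gcdl.
  by rewrite mule1.
set E := _ `&` _.
have mE : measurable E.
  apply: measurableI; first exact: measurable_cylinder.
  exact: (measurable_walk k.+1 [set y | Zp_mul r y <> Zp0]).
have ks : k \notin s by apply/negP => /sk; rewrite ltnn.
rewrite (measure_fibers _ (X k)) //; last by move=> x; apply: (steps_measurable HX).
transitivity (\sum_(x : residue n) (\prod_(i <- s) P (X i @^-1` A i)
   * (n%:R^-1 * survival R k (n %/ gcdn (r * x) n))%:E))%E.
  apply: eq_bigr => x _.
  (* The event that step k equals x joins the cylinder, and x is moved into the starting point: the
     induction hypothesis applies to [k :: s] and to r x. *)
  pose A' i := if i == k then [set x] else A i.
  have Ak i : i \in s -> A' i = A i.
    by move=> si; rewrite /A'; case: eqP => // ik; rewrite -ik si in ks.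
  have -> : X k @^-1` [set x] `&` E = \bigcap_(i in [set` k :: s]) (X i @^-1` A' i)
      `&` [set w | Zp_mul (Zp_mul r x) (walk X k w) <> Zp0].
    have wE w : X k w = x -> Zp_mul (Zp_mul r x) (walk X k w) = Zp_mul r (walk X k.+1 w).
      by move=> <- /=; rewrite -Zp_mulA [Zp_mul (X k w) _]Zp_mulC.
    apply/seteqP; split=> w.
      move=> [/= Xx [C N]]; split; last by rewrite /= (wE w Xx).
      move=> i /=; rewrite inE => /orP[/eqP->|si]; first by rewrite /A' eqxx.
      by rewrite Ak //; apply: C.
    move=> [C N]; have Xx : X k w = x.
      by have := C k; rewrite /= inE eqxx /A' eqxx; apply.
    split=> //; split; last by rewrite /= -(wE w Xx).
    by move=> i /= si; rewrite -Ak //; apply: C; rewrite /= inE si orbT.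
  rewrite IH /=; last 2 first.
  - by rewrite ks.
  - by move=> i; rewrite inE => /orP[/eqP->|/sk/ltnW].
  rewrite big_cons {1}/A' eqxx (steps_uniform HX).
  rewrite (eq_big_seq (fun i => P (X i @^-1` A i))); last by move=> i /Ak ->.
  (* [Zp_mul] reduces modulo [n.-1.+1], which becomes n only after a case analysis; the reduction
     leaves the gcd with n unchanged. *)
  have -> : gcdn (Zp_mul r x) n = gcdn (r * x) n.
    by rewrite /=; case: (n) n0 (nat_of_ord r * nat_of_ord x)%N => // p _ y; rewrite gcdn_modl.
  rewrite EFinM muleA; congr (_ * _)%E.
  by rewrite muleC.
rewrite -ge0_sume_distrr; last first.
  by move=> x _; rewrite lee_fin mulr_ge0 ?survival_ge0 ?invr_ge0.
rewrite sumEFin -mulr_sumr -(survival_step R k n r n0); congr (_ * (_ * _)%:E)%E.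
pose F x := survival R k (n %/ gcdn (r * x) n)%N.
by rewrite -[LHS](big_mkord xpredT F) -[RHS](big_mkord xpredT F); move: F => F; rewrite prednK.
Qed.

Lemma prob_survive (k : nat) : P [set w | walk X k w <> Zp0] = (survival R k n)%:E.
Proof.
(* Specialize to the empty cylinder and the starting point 1. *)
rewrite (_ : [set w | _] = \bigcap_(i in [set` [::]]) (X i @^-1` setT)
    `&` [set w | Zp_mul Zp1 (walk X k w) <> Zp0]); last first.
  by rewrite bigcap_seq big_nil setTI; apply/seteqP; split=> w /=; rewrite Zp_mul1z.
rewrite prob_cylinder_survive // big_nil mul1e; congr (survival _ _ _)%:E.
by rewrite /=; case: (n) n0 => // p _; rewrite gcdn_modl gcd1n divn1.
Qed.

End Walk.

(** * The absorption time as a series of indicators *)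

Section AbsorptionTime.
Variables (R : realType) (n : nat) (Omega : Type) (X : nat -> Omega -> residue n).
Local Open Scope ereal_scope.

Lemma walk_absorbing (k l : nat) (w : Omega) :
  (k <= l)%N -> walk X k w = Zp0 -> walk X l w = Zp0.
Proof.
move=> /subnK <- wk; elim: (l - k)%N => [|j IH] //=.
by rewrite IH; apply: val_inj; rewrite /= mul0n mod0n.
Qed.

(** Since 0 is absorbing, the indicators are 1 before the first hitting time m and 0 from m on, so
    they sum to m. If 0 is never reached, both sides are +oo. *)
Lemma absorption_time_series (w : Omega) :
  absorption_time R X w
  = \sum_(0 <= k <oo) (\1_[set w | walk X k w <> Zp0] w : R)%:E.
Proof.
pose u k : \bar R := (\1_[set w | walk X k w <> Zp0] w)%:E.
rewrite -[RHS]/(\sum_(0 <= k <oo) u k).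
have u0 k : 0 <= u k by rewrite lee_fin.
have u1 k : walk X k w <> Zp0 -> u k = 1 by move=> wk; rewrite /u indicE mem_set.
have sum1 m : (forall k, (k < m)%N -> walk X k w <> Zp0) ->
    \sum_(0 <= k < m) u k = (m%:R)%:E.
  move=> wm; rewrite (eq_big_nat _ _ (F2 := fun=> 1)) => [|k /andP[_ /wm /u1] //].
  by rewrite sumEFin sumr_const_nat subn0.
have [[k wk]|never] := pselect (exists k, walk X k w = Zp0); last first.
  have wN k : walk X k w <> Zp0 by move=> wk; apply: never; exists k.
  rewrite /absorption_time (_ : [set _ | _ in _] = set0) ?ereal_inf0; last first.
    by apply/seteqP; split=> // x [k /= /wN].
  apply/esym/eqyP => A A0.
  (* The partial sums are the integers, which exceed any real A. *)
  apply: le_trans (nneseries_lim_ge (Num.Def.archi_bound A) (fun k _ _ => u0 k)).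
  by rewrite sum1 // lee_fin ltW // archi_boundP // ltW.
have ex : exists k, `[< walk X k w = Zp0 >] by exists k; apply/asboolP.
have [m /asboolP wm mmin] := ex_minnP ex.
have wlt j : (j < m)%N -> walk X j w <> Zp0.
  by move=> jm /asboolP /mmin; rewrite leqNgt jm.
rewrite (nneseries_split 0 m) // add0n sum1 // eseries0 ?adde0; last first.
  by move=> i mi _; rewrite /u indicE memNset // => /(_ (walk_absorbing _ _ _ mi wm)).
apply/eqP; rewrite eq_le; apply/andP; split.
  by apply: ereal_inf_lbound; exists m.
apply/ereal_infP => _ [j /= wj <-]; rewrite lee_fin ler_nat; apply: mmin; exact/asboolP.
Qed.

End AbsorptionTime.

(** * The expectation as a series of survival probabilities *)

Local Open Scope ereal_scope.

(** The terms are nonnegative, so integral and series commute. In particular e is determined by n,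
    whatever the probability space. *)
Lemma expected_absorption_time_series (R : realType) (n : nat) (e : \bar R) :
  (0 < n)%N -> is_expected_absorption_time n e ->
  e = \sum_(0 <= k <oo) (survival R k n)%:E.
Proof.
move=> n0 [d [T [P [X [HX ->]]]]].
have mS k : measurable [set w | walk X k w <> Zp0].
  exact: (measurable_walk _ _ _ _ _ _ HX k [set x | x <> Zp0]).
under eq_integral do rewrite absorption_time_series.
rewrite integral_nneseries //=; last first.
  by move=> k; apply/measurable_realfun.measurable_EFinP; exact: measurable_realfun.measurable_indic.
apply: eq_eseriesr => k _; rewrite integral_indic // setIT.
exact: prob_survive.
Qed.

Lemma nneseriesS_recl (R : realType) (u : nat -> \bar R) : (forall k, 0 <= u k) ->
  \sum_(0 <= k <oo) u k = u 0%N + \sum_(0 <= k <oo) u k.+1.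
Proof.
move=> u0; rewrite (nneseries_split 0 1) // add0n big_nat1; congr (_ + _).
by rewrite -(nneseries_addn 1) //; apply: eq_eseriesr => k _; rewrite addn1.
Qed.

Section SurvivalSeries.
Variable R : realType.
Local Notation a m := (\sum_(0 <= k <oo) (survival R k m)%:E).

Let u0 k m : 0 <= (survival R k m)%:E. Proof. by rewrite lee_fin survival_ge0. Qed.

Lemma survival_series_fin_num (m : nat) : (0 < m)%N -> a m \is a fin_num.
Proof.
move=> m0; have [C CP] := survival_sum_bounded R m m0.
rewrite ge0_fin_numE ?nneseries_ge0 //; apply: (@le_lt_trans _ _ C%:E); last exact: ltry.
apply: lime_le; first exact: is_cvg_nneseries.
by apply: nearW => K; rewrite sumEFin lee_fin big_mkord.
Qed.

(** Split off the term k = 0 and sum [survivalS] over k; nonnegativity allows the finite and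
    infinite sums to be exchanged. *)
Lemma survival_series_rec (m : nat) : (1 < m)%N ->
  m%:R%:E * a m = m%:R%:E + \sum_(d <- divisors m) (totient d)%:R%:E * a d.
Proof.
move=> m1; have m0 := ltnW m1.
rewrite nneseriesS_recl // muleDr ?fin_num_adde_defr //.
have -> : survival R 0 m = 1%R by rewrite /= gtn_eqF.
rewrite mule1.
congr (_ + _); rewrite -nneseriesZl //.
rewrite (eq_eseriesr (g := fun k =>
  \sum_(d <- divisors m) (totient d)%:R%:E * (survival R k d)%:E)); last first.
  move=> k _; rewrite -EFinM survivalS // -sumEFin.
  by apply: eq_bigr => d _; rewrite EFinM.
rewrite nneseries_sum; last by move=> d k _; apply: mule_ge0; [rewrite lee_fin | exact: u0].
by apply: eq_bigr => d _; rewrite nneseriesZl.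
Qed.

End SurvivalSeries.

(** The map d -> n / d is an involution on the divisors of n that swaps 1 and n. *)
Lemma big_divisors_compl (V : nmodType) (F : nat -> V) (n : nat) : (0 < n)%N ->
  (\sum_(d <- divisors n | d != 1%N) F (n %/ d)%N
   = \sum_(d <- divisors n | d != n) F d)%R.
Proof.
move=> n0; have compl d : (d %| n)%N -> (n %/ (n %/ d))%N = d.
  by move=> dn; rewrite divnA // mulKn.
have pe : perm_eq (divisors n) [seq (n %/ d)%N | d <- divisors n].
  apply: uniq_perm => [||d]; first exact: divisors_uniq.
    rewrite map_inj_in_uniq ?divisors_uniq // => c d.
    by rewrite -!dvdn_divisors // => /compl cK /compl dK cd; rewrite -cK cd dK.
  apply/idP/mapP => [|[c]]; rewrite -!dvdn_divisors //.
    by move=> dn; exists (n %/ d)%N; rewrite -?dvdn_divisors ?dvdn_div // compl.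
  by move=> cn ->; apply: dvdn_div.
rewrite (perm_big _ pe) big_map big_seq_cond [RHS]big_seq_cond; apply: eq_big => d.
  rewrite -dvdn_divisors //; case dn: (d %| n)%N => //=; congr negb.
  rewrite -(eqn_pmul2r (dvdn_gt0 n0 dn)) divnK // mul1n eq_sym //.
by rewrite -dvdn_divisors // => /andP[dn _]; rewrite compl.
Qed.

(** * The two formulas for a(n) *)

Theorem theorem2p2 (R : realType) (a : nat -> \bar R)
    (ha : forall m : nat, (0 < m)%N -> is_expected_absorption_time m (a m))
    (n : nat) (hn : (1 < n)%N) :
  a n = (n%:R / (n%:R - (totient n)%:R))%:E
        + \sum_(d <- divisors n | d != 1%N)
            ((totient (n %/ d))%:R%:E * a (n %/ d)%N)
              / (n%:R - (totient n)%:R)%:E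
  /\
  (n%:R / (n%:R - (totient n)%:R))%:E
        + \sum_(d <- divisors n | d != 1%N)
            ((totient (n %/ d))%:R%:E * a (n %/ d)%N)
              / (n%:R - (totient n)%:R)%:E
  = (1 / (n%:R - (totient n)%:R))%:E
      * (n%:R%:E
         + \sum_(d <- divisors n | d != n) (totient d)%:R%:E * a d).
Proof.
have aE m : (0 < m)%N -> a m = \sum_(0 <= k <oo) (survival R k m)%:E.
  by move=> m0; apply: expected_absorption_time_series => //; apply: ha.
have n0 := ltnW hn.
(* All values at divisors of n are finite, so the equations become real ones, where subtraction is
   safe. *)
pose b m := fine (a m).
have ab m : (m %| n)%N -> a m = (b m)%:E.
  move=> mn; have m0 := dvdn_gt0 n0 mn.
  by rewrite /b fineK // aE // survival_series_fin_num.
have D0 : (0 < n%:R - (totient n)%:R :> R)%R by rewrite subr_gt0 ltr_nat ltn_totient.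
set D := (n%:R - (totient n)%:R : R)%R in D0 *.
pose S := (\sum_(d <- divisors n | d != n) (totient d)%:R * b d : R)%R.
have SE : \sum_(d <- divisors n | d != n) (totient d)%:R%:E * a d = S%:E.
  rewrite /S -sumEFin big_seq_cond [RHS]big_seq_cond; apply: eq_bigr => d.
  by rewrite -dvdn_divisors // => /andP[dn _]; rewrite ab.
have S'E : \sum_(d <- divisors n | d != 1%N)
    ((totient (n %/ d))%:R%:E * a (n %/ d)%N) / D%:E = (S / D)%:E.
  rewrite (big_divisors_compl _ (fun d => (totient d)%:R%:E * a d / D%:E)) //.
  rewrite /S mulr_suml -sumEFin big_seq_cond [RHS]big_seq_cond; apply: eq_bigr => d.
  by rewrite -dvdn_divisors // => /andP[dn _]; rewrite ab // inver gt_eqF.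
(* The recursion with its term d = n isolated; moving that term to the left gives D b(n) = n + S. *)
have rec : (n%:R * b n = n%:R + ((totient n)%:R * b n + S) :> R)%R.
  apply: EFin_inj; rewrite EFinM -ab // aE // survival_series_rec //.
  rewrite (bigD1_seq n) ?divisors_uniq -?dvdn_divisors //= !EFinD -SE EFinM -ab // (aE n n0).
  congr (_ + (_ + _)); rewrite big_seq_cond [RHS]big_seq_cond; apply: eq_bigr => d.
  by rewrite -dvdn_divisors // => /andP[dn _]; rewrite aE // (dvdn_gt0 n0).
rewrite S'E SE; split.
  rewrite ab // -EFinD; congr _%:E; apply: (mulIf (lt0r_neq0 D0)).
  rewrite mulrDl !mulfVK ?gt_eqF // /D.
  by move: rec; lra.
by rewrite -!EFinD -EFinM -mulrDl mul1r mulrC.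
Qed.
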